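(* Let $\mathcal{G}=\langle\Upsilon,\mathcal{E}\rangle$ be (the matrix representation of) an instance of ST-Realizability on $n$ vertices. Then its transitive closure $\mathcal{G}^*=\langle\Upsilon^*,\mathcal{E}^*\rangle$ can be computed using $O(\log n)$ repeated applications of the operation $\mathbf{SimpleSquare}$ starting from $\langle\Upsilon,\mathcal{E}\rangle$.
   Context: Realizable strings over $\{push,pop,\epsilon,\alpha_1,\dots,\alpha_k\}$ are the nonempty strings defined recursively by: ''$\alpha_i$''; ''$\alpha_i\,\epsilon\,\alpha_i$''; ''$\alpha_i\ push\ S\ pop\ \alpha_i$'' for realizable $S$; and ''$\alpha_i S_1\alpha_i S_2\alpha_i$'' whenever ''$\alpha_i S_1\alpha_i$'' and ''$\alpha_i S_2\alpha_i$'' are realizable. An instance of ST-Realizability is a directed graph on vertex set $V$, $|V|=n$, with vertex labels $\mathcal{L}(u)\in\{\alpha_1,\dots,\alpha_k\}$ and edge labels in $\{push,pop,\epsilon\}$ (no multi-edges). Write $a\leadsto b$ if there is a directed path from $a$ to $b$ whose concatenated vertex and edge labels form a realizable string. $(a,b)$ is realizable with gap $(c,d)$, written $a\leadsto(c,d)\leadsto b$, if there are directed paths $P_1$ from $a$ to $c$ and $P_2$ from $d$ to $b$, $a,b$ have the same label, $c,d$ have the same label, and the label string of the concatenation of $P_1$ and $P_2$ with $c$ and $d$ identified is realizable. Representation: $\mathcal{E}$ is the $n\times n$ Boolean matrix with $\mathcal{E}[u,v]=1$ iff $(u,v)$ is an edge labeled $\epsilon$, and $\mathcal{E}[u,u]=1$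 for all $u$; $\Upsilon$ is indexed by $[a,(c,d),b]$ with $\Upsilon[a,(c,d),b]=1$ iff ($(a,c)$ is a push edge, $(d,b)$ a pop edge, $\mathcal{L}(a)=\mathcal{L}(b)$, $\mathcal{L}(c)=\mathcal{L}(d)$), or $a=b=c=d$, or ($c=a$ and $d=b$). The transitive closure $\langle\Upsilon^*,\mathcal{E}^*\rangle$ has $\mathcal{E}^*[a,b]=1$ iff $a\leadsto b$ and $\Upsilon^*[a,(c,d),b]=1$ iff $a\leadsto(c,d)\leadsto b$. Products (Boolean $\vee$ for sums, $\wedge$ for products): $(\mathcal{E}_1\otimes_1\mathcal{E}_2)[a,b]=\sum_z\mathcal{E}_1[a,z]\mathcal{E}_2[z,b]$; $(\Upsilon\otimes_2\mathcal{E})[a,b]=\sum_{c,d}\Upsilon[a,(c,d),b]\mathcal{E}[c,d]$; $(\Upsilon\otimes_3\mathcal{E})[a,(c,d),z]=\sum_b\Upsilon[a,(c,d),b]\mathcal{E}[b,z]$; $(\mathcal{E}\otimes_4\Upsilon)[z,(c,d),b]=\sum_a\mathcal{E}[z,a]\Upsilon[a,(c,d),b]$; $(\Upsilon_1\otimes_5\Upsilon_2)[a,(e,f),b]=\sum_{c,d}\Upsilon_1[a,(c,d),b]\Upsilon_2[c,(e,f),d]$; $(\Upsilon\otimes_6\mathcal{E})[a,(c,z),b]=\sum_d\Upsilon[a,(c,d),b]\mathcal{E}[z,d]$; $(\Upsilon\otimes_7\mathcal{E})[a,(z,d),b]=\sum_c\Upsilon[a,(c,d),b]\mathcal{E}[c,z]$.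 $\mathbf{SimpleSquare}(\langle\Upsilon,\mathcal{E}\rangle)$ performs, in order: $\mathcal{E}\leftarrow\mathcal{E}\otimes_1\mathcal{E}$; $\mathcal{E}\leftarrow\Upsilon\otimes_2\mathcal{E}$; $\Upsilon\leftarrow\Upsilon\otimes_3\mathcal{E}$; $\Upsilon\leftarrow\mathcal{E}\otimes_4\Upsilon$; $\Upsilon\leftarrow\Upsilon\otimes_5\Upsilon$; $\Upsilon\leftarrow\Upsilon\otimes_6\mathcal{E}$; $\Upsilon\leftarrow\Upsilon\otimes_7\mathcal{E}$; and returns $\langle\Upsilon,\mathcal{E}\rangle$.
   Formalization: Assumes every a⇝b has a realizable path of length ≤ n^d (d fixed; the O-constant depends on d), as shortest ones can be exponential. Entries of E for ε edges require L(u)=L(v), and the clause ''c=a and d=b'' of Υ requires L(a)=L(b); otherwise the claim is false. *)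

(* Defs.v *)
From mathcomp Require Import all_boot.

Set Implicit Arguments.
Unset Strict Implicit.
Unset Printing Implicit Defensive.

Inductive action := Push | Pop | Eps.

(* The alphabet {push, pop, epsilon, alpha_0, ..., alpha_(k-1)}. *)
Inductive symbol (k : nat) := Act of action | Lab of 'I_k.
Arguments Act {k} _.

Inductive realizable (k : nat) : seq (symbol k) -> Prop :=
| realizable_lab i : realizable [:: Lab i]
| realizable_eps i : realizable [:: Lab i; Act Eps; Lab i]
| realizable_push i S : realizable S ->
    realizable ([:: Lab i; Act Push] ++ S ++ [:: Act Pop; Lab i])
| realizable_cat i S1 S2 :
    realizable (Lab i :: S1 ++ [:: Lab i]) ->
    realizable (Lab i :: S2 ++ [:: Lab i]) ->
    realizable (Lab i :: S1 ++ Lab i :: S2 ++ [:: Lab i]).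

(* [arc u v = Some x] means that (u, v) is an edge labeled x, so there are no
   multi-edges; loops are allowed. *)
Record instance (k : nat) (V : finType) := Instance {
  lab : V -> 'I_k;
  arc : V -> V -> option action
}.

Section Realizability.

Variables (k : nat) (V : finType) (G : instance k V).

Definition edge : rel V := fun u v => isSome (arc G u v).

Definition edge_with (x : action) (u v : V) : bool :=
  match x, arc G u v with
  | Push, Some Push | Pop, Some Pop | Eps, Some Eps => true
  | _, _ => false
  end.

(* Concatenation of the vertex and edge labels along u :: p; it is only used
   for [path edge u p], so the [None] branch is irrelevant. *)
Fixpoint trace (u : V) (p : seq V) : seq (symbol k) :=
  Lab (lab G u) ::
  (if p is v :: p' then
     (if arc G u v is Some x then [:: Act x] else [::]) ++ trace v p'
   else [::]).

(* Paths may repeat vertices; [size p] is the number of edges of u :: p. *)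
Definition realizes (a b : V) (p : seq V) : Prop :=
  [/\ path edge a p, last a p = b & realizable (trace a p)].

Definition reaches (a b : V) : Prop := exists p, realizes a b p.

(* As c and d have the same label, identifying them amounts to dropping the
   label of d in front of the second trace. *)
Definition reaches_gap (a : V) (cd : V * V) (b : V) : Prop :=
  exists p1 p2 : seq V,
    [/\ path edge a p1 /\ last a p1 = cd.1,
        path edge cd.2 p2 /\ last cd.2 p2 = b,
        lab G a = lab G b,
        lab G cd.1 = lab G cd.2 &
        realizable (trace a p1 ++ behead (trace cd.2 p2))].

(* Realizability of two vertices is witnessed by a polynomially long path, as
   for an auxiliary pushdown automaton running in polynomial time. In general
   shortest realizable paths have length exponential in #|V|, whereas one
   application of SimpleSquare below multiplies the length of the paths that
   are accounted for by at most a constant. *)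
Definition poly_bounded (d : nat) : Prop :=
  forall a b, reaches a b -> exists2 p, realizes a b p & size p <= #|V| ^ d.

End Realizability.

Definition Ematrix (V : finType) := V -> V -> bool.
Definition Umatrix (V : finType) := V -> V * V -> V -> bool.
Definition stmatrix (V : finType) := (Umatrix V * Ematrix V)%type.

(* Entries [u, v] and [a, (c, d), b] are set only if u, v, resp. a, b, have the
   same label: an epsilon edge between distinct labels lies on no realizable
   path, and [a, (a, b), b] with distinct labels is not realizable with gap. *)
Definition E_of (k : nat) (V : finType) (G : instance k V) : Ematrix V :=
  fun u v => (u == v) || edge_with G Eps u v && (lab G u == lab G v).

Definition U_of (k : nat) (V : finType) (G : instance k V) : Umatrix V :=
  fun a cd b => let: (c, d) := cd in
  [|| [&& edge_with G Push a c, edge_with G Pop d b,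
          lab G a == lab G b & lab G c == lab G d],
      [&& a == b, b == c & c == d] |
      [&& c == a, d == b & lab G a == lab G b]].

Definition matrices_of (k : nat) (V : finType) (G : instance k V) :
  stmatrix V := (U_of G, E_of G).

Section Products.

Variable V : finType.
Implicit Types (E : Ematrix V) (U : Umatrix V).

Definition prod1 E1 E2 : Ematrix V :=
  fun a b => [exists z, E1 a z && E2 z b].
Definition prod2 U E : Ematrix V :=
  fun a b => [exists c, exists d, U a (c, d) b && E c d].
Definition prod3 U E : Umatrix V :=
  fun a cd z => [exists b, U a cd b && E b z].
Definition prod4 E U : Umatrix V :=
  fun z cd b => [exists a, E z a && U a cd b].
Definition prod5 U1 U2 : Umatrix V :=
  fun a ef b => [exists c, exists d, U1 a (c, d) b && U2 c ef d].
Definition prod6 U E : Umatrix V :=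
  fun a cz b => let: (c, z) := cz in [exists d, U a (c, d) b && E z d].
Definition prod7 U E : Umatrix V :=
  fun a zd b => let: (z, d) := zd in [exists c, U a (c, d) b && E c z].

Definition SimpleSquare (M : stmatrix V) : stmatrix V :=
  let: (U, E) := M in
  let E := prod1 E E in
  let E := prod2 U E in
  let U := prod3 U E in
  let U := prod4 E U in
  let U := prod5 U U in
  let U := prod6 U E in
  let U := prod7 U E in
  (U, E).

End Products.

(* M = <U*, E*>. *)
Definition is_transitive_closure (k : nat) (V : finType) (G : instance k V)
    (M : stmatrix V) : Prop :=
  (forall a b, M.2 a b <-> reaches G a b) /\
  (forall a cd b, M.1 a cd b <-> reaches_gap G a cd b).

Definition bigO_log (t : nat -> nat) : Prop :=
  exists C N, forall n, N <= n -> t n <= C * trunc_log 2 n.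

(* Main.v *)
(* Soundness of SimpleSquare is immediate; the point is that the length of the
   paths accounted for doubles every five rounds. A realizable path of length
   less than 2h has a centroid: a realizable factor of length at least h whose
   immediate constituents are shorter than h. The constituents and the gap
   around the factor are already known, so two rounds yield the path. A path
   with a gap is a sequence of steps towards the gap, which the step crossing
   length h cuts into an outer gap, one step and an inner gap.

   The hypothesis bounds only paths without a gap. Once E* is complete, the
   gaps are the paths of a graph on V * V, where shortest paths have fewer than
   |V|^2 edges, so that 2 log |V| further rounds complete Upsilon*. *)
Require Import Defs.
From mathcomp Require Import all_boot.
From mathcomp Require Import zify.

Set Implicit Arguments.
Unset Strict Implicit.
Unset Printing Implicit Defensive.

(** * Label strings cut at a letter *)

(** Serves to locate the cut letter of a gap relative to the pop of a push production, or to the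
    middle label of a concatenation. *)
Lemma cat_cons_eq (T : Type) (A B s1 s2 : seq T) (x y : T) :
  A ++ x :: B = s1 ++ y :: s2 ->
  [\/ exists2 t, A = s1 ++ y :: t & s2 = t ++ x :: B,
      [/\ A = s1, x = y & B = s2] |
      exists2 t, s1 = A ++ x :: t & B = t ++ y :: s2].
Proof.
elim: A s1 => [|z A IH] [|z' s1] //= [].
- by move=> -> ->; apply: Or32.
- by move=> <- ->; apply: Or33; exists s1.
- by move=> -> <-; apply: Or31; exists A.
move=> -> /IH[[t -> ->]|[-> -> ->]|[t -> ->]].
- by apply: Or31; exists t.
- exact: Or32.
- by apply: Or33; exists t.
Qed.

Lemma realizable_ends k (s : seq (symbol k)) : realizable s ->
  exists i, s = [:: Lab i] \/ exists S, s = Lab i :: S ++ [:: Lab i].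
Proof.
case=> [i|i|i S _|i S1 S2 _ _]; exists i.
- by left.
- by right; exists [:: Act Eps].
- by right; exists (Act Push :: S ++ [:: Act Pop]); rewrite /= -catA.
- by right; exists (S1 ++ Lab i :: S2); rewrite /= -catA.
Qed.

(** Extends [realizable_cat] to factors that may be the single letter [Lab i], a shape that
    constructor excludes. *)
Lemma realizable_join k i (s1 s2 : seq (symbol k)) :
  realizable (s1 ++ [:: Lab i]) -> realizable (Lab i :: s2) ->
  realizable (s1 ++ Lab i :: s2).
Proof.
move=> r1 r2; case: (realizable_ends r1) => i1; case: s1 r1 => [//|x s1] r1 /=.
case; first by case: s1 r1.
case=> S1; rewrite !cats1 => -[ex /rcons_inj[es ei]]; subst x s1 i1.
case: (realizable_ends r2) => i2 [[_ ->]//|[S2 [<- E2]]].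
rewrite E2 in r2 *; rewrite /=.
by apply: realizable_cat; rewrite // cats1.
Qed.

Section Weighted.

Variables (k : nat) (V : finType) (G : instance k V).
Implicit Types (a b c d u v : V) (p q : V * V).

(** * Cutting the trace of a path *)

Lemma edge_withE x u v : edge_with G x u v <-> Defs.arc G u v = Some x.
Proof. by rewrite /edge_with; case: x; case: (Defs.arc G u v) => [[]|]. Qed.

Lemma trace_cons u s : trace G u s = Lab (lab G u) :: behead (trace G u s).
Proof. by case: s. Qed.

Lemma trace_cat u s1 s2 :
  trace G u (s1 ++ s2) = trace G u s1 ++ behead (trace G (last u s1) s2).
Proof.
elim: s1 u => [|v s1 IH] u /=; first exact: trace_cons.
by rewrite IH -catA.
Qed.

Lemma trace_last u s : exists S, trace G u s = S ++ [:: Lab (lab G (last u s))].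
Proof.
elim: s u => [|v s IH] u; first by exists [::].
have [S E] := IH v; eexists (_ :: _ ++ S); rewrite /= E -catA; reflexivity.
Qed.

Lemma trace_split u s s1 j s2 : trace G u s = s1 ++ Lab j :: s2 ->
  exists t1 t2, [/\ s = t1 ++ t2, trace G u t1 = s1 ++ [:: Lab j] &
    trace G (last u t1) t2 = Lab j :: s2].
Proof.
elim: s u s1 => [|v s IH] u [|x s1] E.
- by exists [::], [::]; case: E => <- <-.
- by case: E => _; case: s1.
- exists [::], (v :: s); split=> //.
  by case: E => <- _.
move: E; rewrite /=; case E: (Defs.arc G u v) => [y|] /= [<-].
  case: s1 => [|z s1] //= [<-] /IH[t1 [t2 [-> E1 E2]]].
  by exists (v :: t1), t2; split=> //=; rewrite E E1.
move=> /IH[t1 [t2 [-> E1 E2]]].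
by exists (v :: t1), t2; split=> //=; rewrite E E1.
Qed.

Lemma trace_act u s i x S : trace G u s = [:: Lab i, Act x & S] ->
  exists v t, [/\ s = v :: t, lab G u = i, Defs.arc G u v = Some x &
    trace G v t = S].
Proof.
case: s => [|v s] //=; case E: (Defs.arc G u v) => [y|]; last by case: s.
by case=> <- <- <-; exists v, s.
Qed.

Lemma trace_rcons u s v x : Defs.arc G (last u s) v = Some x ->
  trace G u (rcons s v) = trace G u s ++ [:: Act x; Lab (lab G v)].
Proof. by move=> E; rewrite -cats1 trace_cat /= E. Qed.

Lemma trace_act_last u s S x i :
  path (edge G) u s -> trace G u s = S ++ [:: Act x; Lab i] ->
  exists t v, [/\ s = rcons t v, lab G v = i, Defs.arc G (last u t) v = Some x &
    trace G u t = S].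
Proof.
case/lastP: s => [|t v]; first by case: S => [|? []].
rewrite rcons_path => /andP[_]; rewrite /edge.
case E: (Defs.arc G _ v) => [y|] // _; rewrite (trace_rcons E).
rewrite -!(cat_rcons _ _ [:: _]) !cats1 => /rcons_inj[/rcons_inj[<- <-] <-].
by exists t, v.
Qed.

Lemma trace_nil u s j : trace G u s = [:: Lab j] -> s = [::].
Proof.
by case: s => [|v s] //= [_]; case: (Defs.arc G u v) => // /=; case: s.
Qed.

(** * Derivations on vertices, weighted by path length *)

(** The productions of [realizable] read on vertices instead of strings; the weight is the number of
    edges. *)
Inductive wreach : nat -> V -> V -> Prop :=
| wreach_refl a : wreach 0 a a
| wreach_eps a b : Defs.arc G a b = Some Eps -> lab G a = lab G b ->
    wreach 1 a b
| wreach_push m a c d b : Defs.arc G a c = Some Push -> wreach m c d ->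
    Defs.arc G d b = Some Pop -> lab G a = lab G b -> wreach m.+2 a b
| wreach_cat m1 m2 a c b :
    wreach m1 a c -> wreach m2 c b -> wreach (m1 + m2) a b.

(** One layer of a path around its gap: a matching push and pop, or a realizable path at one of the
    two ends. *)
Inductive step : nat -> V * V -> V * V -> Prop :=
| step_push a b c d : Defs.arc G a c = Some Push -> Defs.arc G d b = Some Pop ->
    lab G a = lab G b -> lab G c = lab G d -> step 2 (a, b) (c, d)
| step_left m a b c : wreach m a c -> lab G a = lab G b ->
    step m (a, b) (c, b)
| step_right m a b d : wreach m d b -> lab G a = lab G b ->
    step m (a, b) (a, d).

(* [gap m (a, b) (c, d)]: paths from a to c and from d to b of total length m
   realize (a, b) with gap (c, d); each step moves both ends inwards. *)
Inductive gap : nat -> V * V -> V * V -> Prop :=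
| gap_nil p : lab G p.1 = lab G p.2 -> gap 0 p p
| gap_cons w m p q r : step w p q -> gap m q r -> gap (w + m) p r.

Lemma wreach_lab m a b : wreach m a b -> lab G a = lab G b.
Proof. by elim=> // *; congruence. Qed.

Lemma wreach0 a b : wreach 0 a b -> a = b.
Proof.
move E: 0 => m r; elim: r E => // m1 m2 {}a c {}b _ IH1 _ IH2 E.
by rewrite IH1 ?IH2 //; lia.
Qed.

Lemma step_lab w p q :
  step w p q -> lab G p.1 = lab G p.2 /\ lab G q.1 = lab G q.2.
Proof. by case=> //= m a b c /wreach_lab; split; congruence. Qed.

Lemma gap_lab m p q :
  gap m p q -> lab G p.1 = lab G p.2 /\ lab G q.1 = lab G q.2.
Proof. by elim=> // w {}m {}p {}q r /step_lab[? _] _ []. Qed.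

Lemma gap_step w p q : step w p q -> gap w p q.
Proof.
move=> st; have [_ lab_q] := step_lab st.
by rewrite -[w]addn0; apply: gap_cons st (gap_nil lab_q).
Qed.

Lemma gap_trans m1 m2 p q r : gap m1 p q -> gap m2 q r -> gap (m1 + m2) p r.
Proof.
elim=> // w m {}p p' {}q st _ IH /IH; rewrite -addnA; exact: gap_cons.
Qed.

(** Each step becomes one [wreach_push] or [wreach_cat] around what the inner steps yield. *)
Lemma gap_fill m1 m2 p q : gap m1 p q -> wreach m2 q.1 q.2 ->
  exists m, wreach m p.1 p.2.
Proof.
elim=> [{}p _|w m {}p p' {}q st _ IH /IH[m']]; first by exists m2.
case: st => /= [a b c d ac db lab_ab _|l a b c r _|l a b d r _] r'.
- by exists m'.+2; apply: wreach_push ac r' db lab_ab.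
- by exists (l + m'); apply: wreach_cat r r'.
- by exists (m' + l); apply: wreach_cat r' r.
Qed.

(** Walk inwards until the accumulated weight reaches [h]; the induction lowers the threshold by the
    weight of each step passed. *)
Lemma gap_threshold m p q h : gap m p q -> 0 < h <= m ->
  exists m1 w m2 p' q', [/\ gap m1 p p', step w p' q', gap m2 q' q,
    m = m1 + w + m2 & m1 < h <= m1 + w].
Proof.
move=> g; elim: g h => [{}p _ h|w {}m {}p p' {}q st g IH h hm]; first by lia.
have [hw|wh] := leqP h w.
  exists 0, w, m, p, p'; split=> //; last by lia.
  by apply: gap_nil; have [] := step_lab st.
have [|m1 [w' [m2 [p1 [q1 [g1 st' g2 -> ?]]]]]] := IH (h - w); first by lia.
exists (w + m1), w', m2, p1, q1; split=> //; try lia.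
exact: gap_cons st g1.
Qed.

(** * Derivations versus realizable paths, without and with a gap *)

Lemma wreach_reaches m a b : wreach m a b -> reaches G a b.
Proof.
elim=> {m a b} [a|a b ab lab_ab|m a c d b ac _ [s [ps ls rs]] db lab_ab|].
- by exists [::]; split=> //; apply: realizable_lab.
- exists [:: b]; split=> //=; rewrite /edge ab ?lab_ab //.
  exact: realizable_eps.
- rewrite -ls in db; exists (c :: rcons s b).
  rewrite /realizes /= last_rcons rcons_path /edge ac db ps (trace_rcons db).
  by rewrite lab_ab; split=> //; apply: realizable_push.
move=> m1 m2 a c b _ [s1 [p1 l1 r1]] _ [s2 [p2 l2 r2]].
exists (s1 ++ s2); split; rewrite ?cat_path ?last_cat ?l1 ?p1 //.
rewrite trace_cat l1.
have [S E] := trace_last a s1; rewrite E -catA /=.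
by apply: realizable_join; rewrite -?E // l1 -trace_cons.
Qed.

Lemma gap_reaches m p q : gap m p q -> reaches_gap G p.1 q p.2.
Proof.
elim=> {m p q} [p lab_p|w m p q r st _ [s1 [s2 [[p1 l1] [p2 l2] lab_q lab_r]]]].
  exists [::], [::]; split=> //; exact: realizable_lab.
case: st l1 p1 l2 p2 lab_q => /=.
- move=> a b c d ac db lab_ab _ l1 p1 l2 p2 _ R.
  exists (c :: s1), (rcons s2 b).
  rewrite -l2 in db.
  split; rewrite //= ?last_rcons ?rcons_path /edge ?ac ?p2 ?db //.
  rewrite (trace_rcons db) lab_ab; have:= realizable_push (lab G b) R.
  by rewrite (trace_cons c s1) (trace_cons r.2 s2) /= -catA.
- move=> m' a b c /wreach_reaches[s [ps ls rs]] lab_ab l1 p1 l2 p2 _ R.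
  exists (s ++ s1), s2; split; rewrite // ?cat_path ?last_cat ?ls ?ps //.
  rewrite trace_cat ls -catA.
  have [S E] := trace_last a s; rewrite E -catA /=.
  apply: realizable_join; rewrite -?E // ls.
  by move: R; rewrite trace_cons.
- move=> m' a b d /wreach_reaches[s [ps ls rs]] lab_ab l1 p1 l2 p2 lab_ad R.
  exists s1, (s2 ++ s); split; rewrite // ?cat_path ?last_cat ?l2 ?p2 //.
  rewrite trace_cat l2 (trace_cons r.2 s2) /= catA.
  set S1 := _ ++ _ in R *.
  have [S2 E2] := trace_last r.2 s2.
  have [S3 E3] := trace_last a s1.
  (* The string built so far must end in the label of [d]. If the right path is empty, its last
     label is that of [r.1], which equals that of [r.2 = d]. *)
  have [S E]: exists S, S1 = S ++ [:: Lab (lab G d)].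
    rewrite /S1; case: S2 E2 => [|x S2] E2; rewrite E2; last first.
      by exists (trace G a s1 ++ S2); rewrite /= l2 -catA.
    by exists S3; rewrite cats0 E3 l1 lab_r -l2 (trace_nil E2).
  rewrite E -catA /=; apply: realizable_join; rewrite -?E //.
  by rewrite -trace_cons.
Qed.

(** Each production prescribes where the path is cut. The exact weight [size t] is what later lets a
    bound on path length enter. *)
Lemma realizable_wreach s : realizable s -> forall a t,
  path (edge G) a t -> trace G a t = s -> wreach (size t) a (last a t).
Proof.
elim=> {s} [i|i|i S rS IH|i S1 S2 _ IH1 _ IH2] a t.
- by move=> _ /trace_nil->; apply: wreach_refl.
- move=> _ /trace_act[v [t' [-> lab_a av E]]].
  have t'0 := trace_nil E; subst t'; case: E => lab_v.
  by apply: wreach_eps; rewrite ?lab_a.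
- move=> pt /trace_act[c [t' [et lab_a ac E]]]; subst t.
  move: pt => /= /andP[_ pt].
  have [t [v [et lab_v dv {}E]]] := trace_act_last pt E; subst t'.
  rewrite last_rcons size_rcons.
  move: pt; rewrite rcons_path => /andP[pt _].
  by apply: wreach_push ac (IH _ _ pt E) dv _; rewrite lab_a.
- rewrite -cat_cons => pt /trace_split[t1 [t2 [et E1 E2]]]; subst t.
  move: pt; rewrite cat_path => /andP[pt1 pt2]; rewrite size_cat last_cat.
  by apply: wreach_cat (IH1 _ _ pt1 E1) (IH2 _ _ pt2 E2).
Qed.

Lemma trace_lab u s x S : trace G u s = Lab x :: S -> lab G u = x.
Proof. by rewrite trace_cons => -[]. Qed.

Lemma trace_lab_last u s x S :
  trace G u s = S ++ [:: Lab x] -> lab G (last u s) = x.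
Proof.
by have [S' ->] := trace_last u s; rewrite !cats1 => /rcons_inj[_].
Qed.

(** The two paths overlap in the letter [Lab j] only, not in a vertex. Induction on the derivation,
    by the position of that letter: at an end of the string, a single step suffices ([first],
    [final]); inside a constituent, one outer step is added to the gap obtained by induction; at the
    joint of a concatenation, there is one step on either side. *)
Lemma realizable_gap s : realizable s -> forall s1 j s2 a t1 d t2,
  s = s1 ++ Lab j :: s2 -> path (edge G) a t1 -> path (edge G) d t2 ->
  trace G a t1 = s1 ++ [:: Lab j] -> trace G d t2 = Lab j :: s2 ->
  exists m, gap m (a, last d t2) (last a t1, d).
Proof.
have first S j s2 a t1 d t2 : realizable S -> S = Lab j :: s2 ->
    path (edge G) d t2 -> trace G a t1 = [:: Lab j] ->
    trace G d t2 = Lab j :: s2 ->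
    exists m, gap m (a, last d t2) (last a t1, d).
  move=> r eS pt2 E1 E2; rewrite -eS in E2.
  have r2 := realizable_wreach r pt2 E2.
  exists (size t2); apply: gap_step; rewrite (trace_nil E1) /=.
  apply: step_right => //; rewrite -(wreach_lab r2) (trace_lab E1).
  by rewrite eS in E2; rewrite (trace_lab E2).
have final S j s1 a t1 d t2 : realizable S -> S = s1 ++ [:: Lab j] ->
    path (edge G) a t1 -> trace G a t1 = s1 ++ [:: Lab j] ->
    trace G d t2 = [:: Lab j] ->
    exists m, gap m (a, last d t2) (last a t1, d).
  move=> r eS pt1 E1 E2.
  have r1 := realizable_wreach r pt1 (etrans E1 (esym eS)).
  exists (size t1); apply: gap_step; rewrite (trace_nil E2) /=.
  apply: step_left => //; rewrite (wreach_lab r1) (trace_lab_last E1).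
  by rewrite (trace_lab E2).
elim=> {s} [i|i|i S rS IH|i S1 S2 r1 IH1 r2 IH2] s1 j s2 a t1 d t2 es pt1 pt2.
- case: s1 es => [|x []] //= [<- <-] E1 E2.
  by apply: (first [:: Lab i]) E1 E2 => //; apply: realizable_lab.
- case: s1 es => [|x [|y [|z []]]] //= [].
    move=> <- <- E1 E2.
    by apply: (first [:: Lab i; Act Eps; Lab i]) E1 E2 => //;
      apply: realizable_eps.
  move=> <- <- <- <- E1 E2.
  by apply: (final _ i [:: Lab i; Act Eps]) E1 E2 => //;
    apply: realizable_eps.
- have rP := realizable_push i rS.
  case: s1 es => [|x [|y s1]] //= [].
    by move=> ej es E1 E2; apply: first rP _ pt2 E1 E2; rewrite -ej -es.
  move=> <- <- {}es E1 E2.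
  have [[t eS es2]|[_ //]|[t es1 et]] := cat_cons_eq es; last first.
    case: t et es1 => [|? []] //= [ej es2] es1; subst s1 j s2.
    rewrite -!cat_cons in E1.
    by apply: final rP _ pt1 E1 E2; rewrite /= -catA.
  have [c [t1' [et1 lab_a ac {}E1]]] := trace_act E1; subst t1.
  rewrite es2 -cat_cons in E2.
  have [t2' [b [et2 lab_b eb {}E2]]] := trace_act_last pt2 E2; subst t2.
  move: pt1 pt2; rewrite /= rcons_path last_rcons => /andP[_ pt1] /andP[pt2 _].
  have [m g] := IH _ _ _ _ _ _ _ eS pt1 pt2 E1 E2.
  have [lab_cb _] := gap_lab g.
  by exists (2 + m); apply: gap_cons g; apply: step_push; rewrite ?lab_a.
- move=> E1 E2; rewrite -cat_cons in es.
  have [[t eS es2]|[es1 [ej] es2]|[t es1 es2]] := cat_cons_eq es.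
  + rewrite es2 -cat_cons in E2.
    have [q1 [q2 [et2 F1 F2]]] := trace_split E2; subst t2.
    move: pt2; rewrite cat_path last_cat => /andP[pt2 pt3].
    have [|m g] := IH1 s1 j (t ++ [:: Lab i]) a t1 d q1 _ pt1 pt2 E1 F1.
      by rewrite -cat_cons eS -catA.
    have r := realizable_wreach r2 pt3 F2.
    have [lab_ad _] := gap_lab g.
    exists (size q2 + m); apply: gap_cons g; apply: step_right => //.
    by rewrite -(wreach_lab r).
  + subst s1 j s2.
    have w1 := realizable_wreach r1 pt1 E1.
    have w2 := realizable_wreach r2 pt2 E2.
    have lab_cb : lab G (last a t1) = lab G (last d t2).
      by rewrite -(wreach_lab w2) (trace_lab_last E1) (trace_lab E2).
    have lab_ab := etrans (wreach_lab w1) lab_cb.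
    exists (size t1 + size t2).
    exact: gap_cons (step_left w1 lab_ab) (gap_step (step_right w2 lab_cb)).
  + rewrite es1 -catA in E1.
    have [q1 [q2 [et1 F1 F2]]] := trace_split E1; subst t1.
    move: pt1; rewrite cat_path last_cat => /andP[pt1 pt3].
    have [|m g] := IH2 (Lab i :: t) j s2 _ q2 d t2 _ pt3 pt2 F2 E2.
      by rewrite /= es2.
    have r := realizable_wreach r1 pt1 F1.
    have [lab_cb _] := gap_lab g.
    exists (size q1 + m); apply: gap_cons g; apply: step_left => //.
    by rewrite (wreach_lab r).
Qed.

Lemma reaches_gapP a cd b :
  reaches_gap G a cd b <-> exists m, gap m (a, b) cd.
Proof.
split=> [[s1 [s2 [[p1 l1] [p2 l2] _ lab_cd R]]]|[m /gap_reaches//]].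
case: cd => c d /= in l1 p2 l2 lab_cd R *.
have [S E] := trace_last a s1.
rewrite E -catA /= in R.
rewrite -l1 -l2; apply: realizable_gap R _ _ _ _ _ _ _ _ p1 p2 E _ => //.
by rewrite trace_cons l1 lab_cd.
Qed.

Lemma reachesP a b : reaches G a b <-> exists m, wreach m a b.
Proof.
split=> [[s [ps ls rs]]|[m /wreach_reaches//]].
by exists (size s); rewrite -ls; apply: realizable_wreach rs _ _ ps _.
Qed.

(** * Soundness of the seven products *)

Implicit Types (E : Ematrix V) (U : Umatrix V) (M : stmatrix V).

Definition Esound E := forall a b, E a b -> exists m, wreach m a b.
Definition Usound U := forall a cd b, U a cd b -> exists m, gap m (a, b) cd.
(** The units thanks to which a product loses no entry of the matrix it updates. *)
Definition Eunital E := forall a, E a a.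
Definition Uunital U := forall a b, lab G a = lab G b -> U a (a, b) b.

Lemma Esound_lab E a b : Esound E -> E a b -> lab G a = lab G b.
Proof. by move=> sE /sE[m /wreach_lab]. Qed.

Lemma Usound_lab U a c d b : Usound U -> U a (c, d) b ->
  lab G a = lab G b /\ lab G c = lab G d.
Proof. by move=> sU /sU[m /gap_lab]. Qed.

Lemma prod1_sound E1 E2 : Esound E1 -> Esound E2 -> Esound (prod1 E1 E2).
Proof.
move=> s1 s2 a b /existsP[z /andP[/s1[m1 r1] /s2[m2 r2]]].
by exists (m1 + m2); apply: wreach_cat r1 r2.
Qed.

Lemma prod2_sound U E : Usound U -> Esound E -> Esound (prod2 U E).
Proof.
move=> sU sE a b /existsP[c /existsP[d /andP[/sU[m1 g] /sE[m2 r]]]].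
exact: gap_fill g r.
Qed.

(** [prod3] and [prod4] add a first step at the outer ends of a gap, [prod6] and [prod7] a last step
    at its inner ends. *)
Lemma prod3_sound U E : Usound U -> Esound E -> Usound (prod3 U E).
Proof.
move=> sU sE a cd z /existsP[b /andP[/sU[m1 g] /sE[m2 r]]].
have [/= lab_ab _] := gap_lab g; have lab_bz := wreach_lab r.
exists (m2 + m1); apply: gap_cons g; apply: step_right r _; congruence.
Qed.

Lemma prod4_sound E U : Esound E -> Usound U -> Usound (prod4 E U).
Proof.
move=> sE sU z cd b /existsP[a /andP[/sE[m2 r] /sU[m1 g]]].
have [/= lab_ab _] := gap_lab g; have lab_za := wreach_lab r.
exists (m2 + m1); apply: gap_cons g; apply: step_left r _; congruence.
Qed.

Lemma prod5_sound U1 U2 : Usound U1 -> Usound U2 -> Usound (prod5 U1 U2).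
Proof.
move=> s1 s2 a ef b /existsP[c /existsP[d /andP[/s1[m1 g1] /s2[m2 g2]]]].
by exists (m1 + m2); apply: gap_trans g1 g2.
Qed.

Lemma prod6_sound U E : Usound U -> Esound E -> Usound (prod6 U E).
Proof.
move=> sU sE a [c z] b /existsP[d /andP[/sU[m1 g] /sE[m2 r]]].
have [_ /= lab_cd] := gap_lab g.
by exists (m1 + m2); apply: gap_trans g (gap_step (step_right r lab_cd)).
Qed.

Lemma prod7_sound U E : Usound U -> Esound E -> Usound (prod7 U E).
Proof.
move=> sU sE a [z d] b /existsP[c /andP[/sU[m1 g] /sE[m2 r]]].
have [_ /= lab_cd] := gap_lab g.
by exists (m1 + m2); apply: gap_trans g (gap_step (step_left r lab_cd)).
Qed.

Record invariant M : Prop := Invariant {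
  inv_Esound : Esound M.2;
  inv_Usound : Usound M.1;
  inv_Eunital : Eunital M.2;
  inv_Uunital : Uunital M.1
}.

Lemma matrices_of_invariant : invariant (matrices_of G).
Proof.
split=> /= [a b|a [c d] b|a|a b lab_ab].
- case/orP=> [/eqP<-|/andP[/edge_withE ab /eqP lab_ab]].
    by exists 0; apply: wreach_refl.
  by exists 1; apply: wreach_eps.
- case/or3P=> [/and4P[]|/and3P[]|/and3P[]].
  + move=> /edge_withE ac /edge_withE db /eqP lab_ab /eqP lab_cd.
    by exists 2; apply: gap_step; apply: step_push.
  + by move=> /eqP-> /eqP-> /eqP->; exists 0; apply: gap_nil.
  + by move=> /eqP-> /eqP-> /eqP lab_ab; exists 0; apply: gap_nil.
- by rewrite /E_of eqxx.
- by rewrite /U_of !eqxx lab_ab eqxx !orbT.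
Qed.

(** * The effect of one round *)

Definition le M M' := (forall a b, M.2 a b -> M'.2 a b) /\
  (forall a cd b, M.1 a cd b -> M'.1 a cd b).

(** The interface through which the completeness argument uses a round: nothing is lost, and each
    rule for building paths or gaps can be applied once. *)
Record square_spec M M' : Prop := SquareSpec {
  sq_inv : invariant M';
  sq_le : le M M';
  sq_cat a c b : M.2 a c -> M.2 c b -> M'.2 a b;
  sq_fill a c d b : M.1 a (c, d) b -> M.2 c d -> M'.2 a b;
  sq_comp a c d ef b : M.1 a (c, d) b -> M.1 c ef d -> M'.1 a ef b;
  sq_left a b c : lab G a = lab G b -> M.2 a c -> M'.1 a (c, b) b;
  sq_right a b d : lab G a = lab G b -> M.2 d b -> M'.1 a (a, d) b
}.

(** By the units, every product enlarges its argument, so an entry created by one product survives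
    the later ones. [sq_cat] comes from [prod1], [sq_fill] from [prod2], [sq_comp] from [prod5],
    [sq_right] from [prod6] and [sq_left] from [prod7]. *)
Lemma SimpleSquareP M : invariant M -> square_spec M (SimpleSquare M).
Proof.
case: M => U E [/= sE sU eE uU].
rewrite /SimpleSquare.
set E1 := prod1 E E.
set E2 := prod2 U E1.
set U1 := prod3 U E2.
set U2 := prod4 E2 U1.
set U3 := prod5 U2 U2.
set U4 := prod6 U3 E2.
set U5 := prod7 U4 E2.
have sE1 : Esound E1 by apply: prod1_sound.
have sE2 : Esound E2 by apply: prod2_sound.
have sU1 : Usound U1 by apply: prod3_sound.
have sU2 : Usound U2 by apply: prod4_sound.
have sU3 : Usound U3 by apply: prod5_sound.
have sU4 : Usound U4 by apply: prod6_sound.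
have sU5 : Usound U5 by apply: prod7_sound.
have leE1 a b : E a b -> E1 a b.
  by move=> Eab; apply/existsP; exists b; rewrite Eab eE.
have leE2 a b : E1 a b -> E2 a b.
  move=> Eab; apply/existsP; exists a; apply/existsP; exists b.
  (* [Uunital] speaks of equally labeled pairs; soundness of [E1] provides the equality. *)
  by rewrite Eab uU //; apply: Esound_lab Eab.
have eE2 a : E2 a a by apply/leE2/leE1.
have leU1 a cd b : U a cd b -> U1 a cd b.
  by move=> Ua; apply/existsP; exists b; rewrite Ua eE2.
have leU2 a cd b : U1 a cd b -> U2 a cd b.
  by move=> Ua; apply/existsP; exists a; rewrite Ua eE2.
have uU2 : Uunital U2 by move=> a b lab_ab; apply/leU2/leU1/uU.
have leU3 a cd b : U2 a cd b -> U3 a cd b.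
  case: cd => c d Ua; apply/existsP; exists c; apply/existsP; exists d.
  by rewrite Ua uU2 //; have [] := Usound_lab sU2 Ua.
have leU4 a cd b : U3 a cd b -> U4 a cd b.
  by case: cd => c d Ua; apply/existsP; exists d; rewrite Ua eE2.
have leU5 a cd b : U4 a cd b -> U5 a cd b.
  by case: cd => c d Ua; apply/existsP; exists c; rewrite Ua eE2.
have leU a cd b : U a cd b -> U2 a cd b by move=> ?; apply/leU2/leU1.
have left a b c : lab G a = lab G b -> E a c -> U5 a (c, b) b.
  move=> lab_ab Eac; apply/existsP; exists a; apply/andP; split.
    exact/leU4/leU3/uU2.
  exact/leE2/leE1.
have right a b d : lab G a = lab G b -> E d b -> U5 a (a, d) b.
  move=> lab_ab Edb; apply/leU5/existsP; exists b; apply/andP; split.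
    exact/leU3/uU2.
  exact/leE2/leE1.
split=> /=.
- split=> //= a b lab_ab; exact/leU5/leU4/leU3/uU2.
- split=> /= [a b ?|a cd b ?]; first exact/leE2/leE1.
  exact/leU5/leU4/leU3/leU.
- move=> a c b Eac Ecb; apply/leE2/existsP; exists c; exact/andP.
- move=> a c d b Ua Ecd; apply/existsP; exists c; apply/existsP; exists d.
  by rewrite Ua leE1.
- move=> a c d ef b Ua Uc; apply/leU5/leU4/existsP; exists c.
  by apply/existsP; exists d; rewrite !leU.
- exact: left.
- exact: right.
Qed.

(** * Doubling the weight accounted for *)

Definition squares t := iter t (@SimpleSquare V) (matrices_of G).

Lemma squares_invariant t : invariant (squares t).
Proof.
elim: t => [|t /SimpleSquareP[]//]; exact: matrices_of_invariant.
Qed.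

Lemma squaresS t : square_spec (squares t) (squares t.+1).
Proof. exact/SimpleSquareP/squares_invariant. Qed.

Lemma squares_le t1 t2 : t1 <= t2 -> le (squares t1) (squares t2).
Proof.
move/subnK<-; elim: (t2 - t1) => [//|n [IHE IHU]].
have [leE leU] := sq_le (squaresS (n + t1)).
by split=> [a b /IHE/leE|a cd b /IHU/leU].
Qed.

Definition complete_below h t :=
  (forall m a b, m < h -> wreach m a b -> (squares t).2 a b) /\
  (forall m p q, m < h -> gap m p q -> (squares t).1 p.1 q p.2).

Lemma arc_push_pop a b c d t :
  Defs.arc G a c = Some Push -> Defs.arc G d b = Some Pop ->
  lab G a = lab G b -> lab G c = lab G d -> (squares t).1 a (c, d) b.
Proof.
move=> ac db lab_ab lab_cd; have [_ leU] := squares_le (leq0n t).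
apply/leU/or3P/Or31/and4P; rewrite lab_ab lab_cd.
by split=> //; apply/edge_withE.
Qed.

(** At weight 0 only the units are left: a push and pop weigh 2, and the other steps then follow
    trivial paths and do not move. *)
Lemma complete_below1 : complete_below 1 0.
Proof.
have [_ _ eE uU] := squares_invariant 0.
split=> [m a b|m p q]; rewrite ltnS leqn0 => /eqP->.
  by move=> /wreach0->; apply: eE.
move E: 0 => n g; elim: g E => {n p q} [[a b] lab_ab _|w n p q r st g IH E].
  exact: uU.
have [w0 n0] : w = 0 /\ n = 0 by lia.
subst w n; suff -> : p = q by apply: IH.
by move E0: 0 st => z st; case: st E0 => // [? ? ? ? r' _ z0|? ? ? ? r' _ z0];
  rewrite -z0 in r'; rewrite (wreach0 r').
Qed.

(** Descend into a constituent of weight at least [h] as long as there is one; the layers and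
    siblings passed become the steps of the gap. Where the descent stops, all constituents are
    lighter than [h], and one round combines them. *)
Lemma wreach_centroid h t m a b : complete_below h t -> 0 < h <= m ->
  wreach m a b -> exists g w c d, [/\ gap g (a, b) (c, d), g + w = m, h <= w &
    (squares t.+1).2 c d].
Proof.
move=> [cE cU] /andP[h0 +] r.
(* The descent stops here, with the empty gap. *)
have base m' a' b' : wreach m' a' b' -> h <= m' -> (squares t.+1).2 a' b' ->
    exists g w c d, [/\ gap g (a', b') (c, d), g + w = m', h <= w &
      (squares t.+1).2 c d].
  by move=> r' hm Eab; exists 0, m', a', b'; split=> //;
    apply: (@gap_nil (a', b')) (wreach_lab r').
elim: r => {m a b} [a|a b ab lab_ab|m a c d b ac r IH db lab_ab|].
- by lia.
- move=> hm; apply: base => //; first exact: wreach_eps.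
  have [leE _] := squares_le (leq0n t.+1).
  apply/leE/orP; right; rewrite lab_ab eqxx andbT.
  exact/edge_withE.
- move=> hm; have [/IH[g [w [x [y [g1 <- hw Exy]]]]]|mh] := leqP h m.
    exists (2 + g), w, x, y; split=> //.
    by apply: gap_cons g1; apply: step_push => //; apply: wreach_lab r.
  apply: base => //; first exact: wreach_push ac r db lab_ab.
  apply: (sq_fill (squaresS t)) (cE _ _ _ mh r).
  by apply: arc_push_pop => //; apply: wreach_lab r.
move=> m1 m2 a c b r1 IH1 r2 IH2 hm.
have lab_cb := wreach_lab r2.
have lab_ab := etrans (wreach_lab r1) lab_cb.
have [/IH1[g [w [x [y [g1 <- hw Exy]]]]]|m1h] := leqP h m1.
  exists (m2 + g), w, x, y; split=> //; last by lia.
  exact: gap_cons (step_right r2 lab_ab) g1.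
have [/IH2[g [w [x [y [g1 <- hw Exy]]]]]|m2h] := leqP h m2.
  exists (m1 + g), w, x, y; split=> //; last by lia.
  exact: gap_cons (step_left r1 lab_ab) g1.
apply: base => //; first exact: wreach_cat r1 r2.
exact: (sq_cat (squaresS t)) (cE _ _ _ m1h r1) (cE _ _ _ m2h r2).
Qed.

(** The five rounds: the centroid, the filling of the gap around it, the conversion of entries of
    [E] into steps, and two compositions, with the inner and then with the outer gap. *)
Lemma complete_double h t : 0 < h -> complete_below h t ->
  complete_below h.*2 (t + 5).
Proof.
move=> h0 C; have [cE cU] := C.
have cE2 m a b : m < h.*2 -> wreach m a b -> (squares t.+2).2 a b.
  move=> mh r; have [hm|mh'] := leqP h m; last first.
    have [leE _] := squares_le (leqW (leqnSn t)).
    exact/leE/(cE _ _ _ mh').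
  have [|g [w [c [d [gp E hw Ecd]]]]] := wreach_centroid C _ r; first by lia.
  (* The gap around the centroid weighs [m - w], less than [h]. *)
  apply: (sq_fill (squaresS t.+1)) Ecd.
  have [_ leU] := sq_le (squaresS t); apply: leU.
  by apply: (cU g (a, b)) => //; lia.
have cU3 w p q : w < h.*2 -> step w p q -> (squares t.+3).1 p.1 q p.2.
  move=> wh st; case: st wh.
  - by move=> a b c d ac db lab_ab lab_cd _; exact: arc_push_pop.
  - move=> m a b c r lab_ab mh.
    exact: (sq_left (squaresS t.+2)) lab_ab (cE2 _ _ _ mh r).
  - move=> m a b d r lab_ab mh.
    exact: (sq_right (squaresS t.+2)) lab_ab (cE2 _ _ _ mh r).
split=> [m a b mh /(cE2 _ _ _ mh)|m p q mh g].
  by have [leE _] := @squares_le t.+2 (t + 5) ltac:(lia); apply: leE.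
have [leU3 leU5] : (forall a cd b, (squares t).1 a cd b ->
    (squares t.+3).1 a cd b) /\
  (forall a cd b, (squares t).1 a cd b -> (squares (t + 5)).1 a cd b).
  by split; [have [] := @squares_le t t.+3 ltac:(lia) |
    have [] := @squares_le t (t + 5) ltac:(lia)].
have [hm|mh'] := leqP h m; last exact: leU5 (cU _ _ _ mh' g).
have [|m1 [w [m2 [[x y] [[x' y'] [g1 st g2 E hw]]]]]] :=
  gap_threshold g (h := h).
  by lia.
(* The inner gap weighs less than [h], as [h <= m1 + w] and [m < h.*2]. The crossing step itself may
   weigh more, hence [cU3]. *)
have Uxy : (squares t.+4).1 x q y.
  apply: (sq_comp (squaresS t.+3)) (cU3 _ (x, y) _ _ st) _; first by lia.
  by apply: leU3; apply: (cU m2 (x', y')) => //; lia.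
rewrite addnS addn4; apply: (sq_comp (squaresS t.+4)) Uxy.
have [_ leU4] := @squares_le t t.+4 ltac:(lia).
by apply: leU4; apply: (cU m1 p) => //; lia.
Qed.

Lemma complete_expn s : complete_below (2 ^ s) (5 * s).
Proof.
elim: s => [|s IH]; first exact: complete_below1.
by rewrite expnS mul2n mulnS addnC; apply: complete_double; rewrite ?expn_gt0.
Qed.

(** * Completing the gaps by paths on pairs of vertices *)

Definition move t : rel (V * V) := fun p q => (squares t).1 p.1 q p.2.

(** Repeated squaring: the path is cut after [2 ^ j] edges and one more round composes the two
    parts. *)
Lemma squares_path t j p s : lab G p.1 = lab G p.2 -> path (move t) p s ->
  size s <= 2 ^ j -> (squares (t + j)).1 p.1 (last p s) p.2.
Proof.
elim: j p s => [|j IH] p s lab_p ps.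
  rewrite addn0; case: s ps => [|q [|//]] /=; last by rewrite andbT.
  move=> _ _; case: p lab_p => a b.
  exact: inv_Uunital (squares_invariant t) _ _.
rewrite expnS => size_s; move: ps; rewrite -(cat_take_drop (2 ^ j) s).
rewrite cat_path last_cat => /andP[ps1 ps2].
have {}ps1 : (squares (t + j)).1 p.1 (last p (take (2 ^ j) s)) p.2.
  by apply: IH lab_p ps1 _; rewrite size_take; case: ltnP.
set q := last p _ in ps1 ps2 *.
(* Soundness of the first part gives equal labels at the midpoint, as the induction hypothesis
   demands. *)
have [m g] := inv_Usound (squares_invariant _) ps1.
have [_ lab_q] := gap_lab g.
rewrite addnS; case: q ps1 ps2 {g} lab_q => c d ps1 ps2 lab_q.
apply: (sq_comp (squaresS _)) ps1 (IH _ _ lab_q ps2 _).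
by rewrite size_drop leq_subLR addnn -mul2n.
Qed.

Lemma squares_closure (l d : nat) : #|V| < 2 ^ l -> poly_bounded G d ->
  is_transitive_closure G (squares (5 * (d * l + 1) + 1 + (l + l))).
Proof.
(* [T] spends five rounds per doubling up to [2 ^ (d * l + 1)]; the added 1 keeps the bound strict
   when [d = 0]. *)
move=> Vl bnd; set T := 5 * _; set N := _ + _.
have VdT : #|V| ^ d < 2 ^ (d * l + 1).
  apply: leq_ltn_trans (_ : 2 ^ (d * l) < _); last by rewrite ltn_exp2l ?addn1.
  rewrite mulnC expnM; case: (posnP d) => [->|d0] //.
  by rewrite leq_exp2r // ltnW.
have reachT m a b : wreach m a b -> (squares T).2 a b.
  move=> /wreach_reaches/bnd[s [ps ls rs] size_s].
  have [cE _] := complete_expn (d * l + 1).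
  apply: (cE (size s)); first exact: leq_ltn_trans VdT.
  by rewrite -ls; apply: realizable_wreach rs _ _ ps _.
have [invE invU _ _] := squares_invariant N.
split=> [a b|a cd b].
  rewrite reachesP; split=> [/invE//|[m /reachT Eab]].
  have [leE _] := @squares_le T N ltac:(lia); exact: leE.
rewrite reaches_gapP; split=> [/invU//|[m g]].
have [lab_ab _] := gap_lab g.
(* With [E] complete after [T] rounds, one more round makes every step an edge of [move], whatever
   its weight; from here on only the number of steps counts. *)
have : connect (move T.+1) (a, b) cd.
  elim: g => {m a b cd lab_ab} [p _|w m p q r st _ IH]; first exact: connect0.
  apply: connect_trans IH; apply: connect1; case: st.
  - by move=> a b c c' ac db lab_ab lab_cd; apply: arc_push_pop.
  - by move=> m' a b c /reachT Eac lab_ab; apply: (sq_left (squaresS T)).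
  - by move=> m' a b c /reachT Ecb lab_ab; apply: (sq_right (squaresS T)).
(* A path without repetitions has at most [#|V| * #|V|] vertices, hence fewer than [2 ^ (l + l)]
   edges. *)
case/connectP=> s ps ->; case/shortenP: ps => s' ps' /card_uniqP size_s' _.
rewrite /N addn1; apply: (@squares_path _ _ (a, b)) => //.
apply: leq_trans (leqnSn _) _; rewrite -[(size s').+1]size_s' expnD.
apply: leq_trans (max_card _) _; rewrite card_prod.
by rewrite leq_mul // ltnW.
Qed.

End Weighted.

(** * Counting the rounds *)

Theorem theorem9 (d : nat) :
  exists t : nat -> nat, bigO_log t /\
    forall (k : nat) (V : finType) (G : instance k V), poly_bounded G d ->
      is_transitive_closure G (iter (t #|V|) (@SimpleSquare V) (matrices_of G)).
Proof.
(* The successor makes [n < 2 ^ l n] hold for every [n], including 0. *)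
pose l n := (trunc_log 2 n).+1.
exists (fun n => 5 * (d * l n + 1) + 1 + (l n + l n)); split.
  (* With [L] the logarithm, the count is [(5 * d + 2) * L + (5 * d + 8)]; since [L >= 1] for
     [n >= 2], the constant term is absorbed. *)
  exists (10 * d + 10), 2 => n n2.
  have : 0 < trunc_log 2 n by rewrite trunc_log_gt0.
  by rewrite /l; nia.
by move=> k V G bnd; apply: squares_closure bnd; apply: trunc_log_ltn.
Qed.
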